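(* Let $\mathcal{C}$ be a category and let $\mathcal{Y}:\mathcal{C}^{op}\to Grpds$ be a prestack over $\mathcal{C}$. Then for each object $X$ of $\mathcal{C}$ there exists an equivalence of categories $$\mathcal{Y}(X)\;\cong\; Mor_{PreStk_{\mathcal{C}}}(\underline{X},\mathcal{Y}),$$ where $\underline{X}$ denotes the presheaf of sets $Mor_{\mathcal{C}}(\cdot,X)$ regarded as a prestack, and $Mor_{PreStk_{\mathcal{C}}}(\underline{X},\mathcal{Y})$ is the category whose objects are the 1-morphisms of prestacks $\underline{X}\to\mathcal{Y}$ and whose morphisms are the 2-morphisms between them.
   Context: $Grpds$ is the 2-category of groupoids: objects are groupoids (categories in which all morphisms are isomorphisms), 1-morphisms are functors, 2-morphisms are natural transformations. Write $\circ$ for composition of functors and for vertical composition of natural transformations, and $\star$ for horizontal composition. **Prestack.** A prestack $\mathcal{Y}$ on a category $\mathcal{C}$ is a contravariant pseudo-functor $\mathcal{Y}:\mathcal{C}^{op}\to Grpds$, i.e. it consists of: a groupoid $\mathcal{Y}(A)$ for each object $A$ of $\mathcal{C}$; a functor $\mathcal{Y}(f):\mathcal{Y}(B)\to\mathcal{Y}(A)$ for each morphism $f:A\to B$, with $\mathcal{Y}(id_A)=id_{\mathcal{Y}(A)}$; and for each composable pair $A\xrightarrow{f}B\xrightarrow{g}C$ an invertible natural transformation $\phi^{\mathcal{Y}}_{g,f}:\mathcal{Y}(g\circ f)\Rightarrow\mathcal{Y}(f)\circ\mathcal{Y}(g)$, such that $\phi^{\mathcal{Y}}_{f,id_A}=\phi^{\mathcal{Y}}_{id_B,f}=id_{\mathcal{Y}(f)}$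 for $f:A\to B$, and for each composable triple $A\xrightarrow{f}B\xrightarrow{g}C\xrightarrow{h}D$ one has $$(id_{\mathcal{Y}(f)}\star\phi^{\mathcal{Y}}_{h,g})\circ\phi^{\mathcal{Y}}_{h\circ g,f}=(\phi^{\mathcal{Y}}_{g,f}\star id_{\mathcal{Y}(h)})\circ\phi^{\mathcal{Y}}_{h,g\circ f}.$$ **The prestack $\underline{X}$.** For an object $X$ of $\mathcal{C}$, $\underline{X}(A)$ is the set $Mor_{\mathcal{C}}(A,X)$ viewed as a groupoid with only identity morphisms, $\underline{X}(f)$ is precomposition with $f$, and all $\phi^{\underline{X}}_{g,f}$ are identities. **1-morphism of prestacks.** A 1-morphism $F:\mathcal{X}\to\mathcal{Y}$ of prestacks on $\mathcal{C}$ consists of a functor $F_A:\mathcal{X}(A)\to\mathcal{Y}(A)$ for each object $A$ of $\mathcal{C}$ and, for each morphism $f:A\to B$ of $\mathcal{C}$, an invertible natural transformation $F_f:F_A\circ\mathcal{X}(f)\Rightarrow\mathcal{Y}(f)\circ F_B$, such that for each composable pair $A\xrightarrow{f}B\xrightarrow{g}C$, $$F_{g\circ f}=\big((\phi^{\mathcal{Y}}_{g,f})^{-1}\star id_{F_C}\big)\circ\big(id_{\mathcal{Y}(f)}\star F_g\big)\circ\big(F_f\star id_{\mathcal{X}(g)}\big)\circ\big(id_{F_A}\star\phi^{\mathcal{X}}_{g,f}\big).$$ **2-morphism of prestacks.** For 1-morphisms $F,G:\mathcal{X}\to\mathcal{Y}$, a 2-morphism $\Psi:F\Rightarrow G$ is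 a collection $\{\Psi_A:F_A\Rightarrow G_A : A\in Ob(\mathcal{C})\}$ of invertible natural transformations of functors, one for each object $A$ of $\mathcal{C}$. $PreStk_{\mathcal{C}}$ is the 2-category of prestacks over $\mathcal{C}$ with these 1-morphisms and 2-morphisms.
   Formalization: 2-morphisms Ψ: F ⇒ G of prestacks are additionally required to be compatible with F_f and G_f for every f: A → B, i.e. (id_{Y(f)} ⋆ Ψ_B) ∘ F_f = G_f ∘ (Ψ_A ⋆ id_{X(f)}); without this condition the claimed equivalence is false. *)

(* Defs.v *)
From Stdlib Require Import FunctionalExtensionality ProofIrrelevance.

Set Implicit Arguments.
Unset Strict Implicit.
Unset Printing Implicit Defensive.

Declare Scope cat_scope.
Delimit Scope cat_scope with cat.
Local Open Scope cat_scope.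

(** Equality of objects and of morphisms is Leibniz equality; functional
    extensionality and proof irrelevance make it the extensional one. *)

Record Category : Type := {
  ob :> Type;
  hom : ob -> ob -> Type;
  idm : forall x : ob, hom x x;
  comp : forall x y z : ob, hom y z -> hom x y -> hom x z;
  comp_id_l : forall (x y : ob) (f : hom x y), comp (idm y) f = f;
  comp_id_r : forall (x y : ob) (f : hom x y), comp f (idm x) = f;
  comp_assoc : forall (x y z w : ob) (h : hom z w) (g : hom y z) (f : hom x y),
    comp h (comp g f) = comp (comp h g) f
}.
Arguments hom {c} _ _.
Arguments idm {c} _.
Arguments comp {c x y z} _ _.
Arguments comp_assoc {c x y z w} _ _ _.

Infix "∘" := comp (at level 40, left associativity) : cat_scope.

Definition is_iso (C : Category) (x y : C) (f : hom x y) : Prop :=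
  exists g : hom y x, g ∘ f = idm x /\ f ∘ g = idm y.

Record Groupoid : Type := {
  gpd_cat :> Category;
  gpd_iso : forall (x y : gpd_cat) (f : hom x y), is_iso f
}.

Definition eq_hom (C : Category) (x y : C) (e : x = y) : hom x y :=
  match e in _ = z return hom x z with eq_refl => idm x end.

(** [is_identity f], for [f : hom x y]: the objects [x] and [y] are equal and
    [f] is the identity morphism. *)
Inductive is_identity (C : Category) (x : C) : forall y : C, hom x y -> Prop :=
  | is_identity_idm : is_identity (idm x).

Record Functor (C D : Category) : Type := {
  fobj :> C -> D;
  fmap : forall x y : C, hom x y -> hom (fobj x) (fobj y);
  fmap_id : forall x : C, fmap (idm x) = idm (fobj x);
  fmap_comp : forall (x y z : C) (g : hom y z) (f : hom x y),
    fmap (g ∘ f) = fmap g ∘ fmap f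
}.
Arguments fmap {C D} _ {x y} _.

Definition functor_id (C : Category) : Functor C C.
Proof.
refine {| fobj := fun x : C => x; fmap := fun x y (f : hom x y) => f |};
  reflexivity.
Defined.

Definition functor_comp (C D E : Category) (G : Functor D E) (F : Functor C D) :
  Functor C E.
Proof.
refine {| fobj := fun x : C => G (F x);
          fmap := fun x y (f : hom x y) => fmap G (fmap F f) |}.
- intros x; now rewrite !fmap_id.
- intros x y z g f; now rewrite !fmap_comp.
Defined.

Record NatTrans (C D : Category) (F G : Functor C D) : Type := {
  nt :> forall x : C, hom (F x) (G x);
  nt_natural : forall (x y : C) (f : hom x y),
    fmap G f ∘ nt x = nt y ∘ fmap F f
}.

Record NatIso (C D : Category) (F G : Functor C D) : Type := {
  ni :> NatTrans F G;
  ni_inv : NatTrans G F;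
  ni_inv_l : forall x : C, ni_inv x ∘ ni x = idm (F x);
  ni_inv_r : forall x : C, ni x ∘ ni_inv x = idm (G x)
}.

Definition nt_id (C D : Category) (F : Functor C D) : NatTrans F F.
Proof.
refine {| nt := fun x => idm (F x) |}.
intros x y f; now rewrite comp_id_l, comp_id_r.
Defined.

Definition nt_comp (C D : Category) (F G H : Functor C D)
  (b : NatTrans G H) (a : NatTrans F G) : NatTrans F H.
Proof.
refine {| nt := fun x => b x ∘ a x |}.
intros x y f.
now rewrite comp_assoc, nt_natural, <- comp_assoc, nt_natural, comp_assoc.
Defined.

Definition ni_id (C D : Category) (F : Functor C D) : NatIso F F.
Proof.
refine {| ni := nt_id F; ni_inv := nt_id F |};
  intros x; apply comp_id_l.
Defined.

Definition ni_comp (C D : Category) (F G H : Functor C D)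
  (b : NatIso G H) (a : NatIso F G) : NatIso F H.
Proof.
refine {| ni := nt_comp b a; ni_inv := nt_comp (ni_inv a) (ni_inv b) |};
  intros x; simpl.
- now rewrite <- comp_assoc, (comp_assoc (ni_inv b x)), ni_inv_l,
    comp_id_l, ni_inv_l.
- now rewrite <- comp_assoc, (comp_assoc (a x)), ni_inv_r,
    comp_id_l, ni_inv_r.
Defined.

Definition cat_equivalent (C D : Category) : Prop :=
  exists (F : Functor C D) (G : Functor D C),
    inhabited (NatIso (functor_id C) (functor_comp G F)) /\
    inhabited (NatIso (functor_comp F G) (functor_id D)).

(** Equalities between natural transformations are stated at each object, where
    the associativity and unit laws of composition of functors hold by
    computation: at [x], the horizontal composite of [id_H] with [a] is
    [fmap H (a x)], and that of [a] with [id_H] is [a (H x)].  The equality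
    [h ∘ (g ∘ f) = (h ∘ g) ∘ f] in the base category is not a conversion;
    in [pst_coh] it is crossed with [eq_hom].  In [pst_phi_id_r] and
    [pst_phi_id_l] the source and target functors are equal by [comp_id_r],
    [comp_id_l] and [pst_map_id], again not by conversion, hence the use of
    [is_identity]. *)

Record Prestack (C : Category) : Type := {
  pst :> C -> Groupoid;
  pst_map : forall A B : C, hom A B -> Functor (pst B) (pst A);
  pst_map_id : forall A : C, pst_map (idm A) = functor_id (pst A);
  pst_phi : forall (A B D : C) (g : hom B D) (f : hom A B),
    NatIso (pst_map (g ∘ f)) (functor_comp (pst_map f) (pst_map g));
  pst_phi_id_r : forall (A B : C) (f : hom A B) (y : pst B),
    is_identity (pst_phi f (idm A) y);
  pst_phi_id_l : forall (A B : C) (f : hom A B) (y : pst B),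
    is_identity (pst_phi (idm B) f y);
  pst_coh : forall (A B D E : C) (h : hom D E) (g : hom B D) (f : hom A B)
      (z : pst E),
    fmap (pst_map f) (pst_phi h g z) ∘ pst_phi (h ∘ g) f z
      ∘ eq_hom (f_equal (fun k => pst_map k z) (comp_assoc h g f))
    = pst_phi g f (pst_map h z) ∘ pst_phi h (g ∘ f) z
}.
Arguments pst_map {C} _ {A B} _.
Arguments pst_phi {C} _ {A B D} _ _.

(** A type viewed as a groupoid: a morphism from [x] to [y] is a proof of
    [x = y], hence, by proof irrelevance, an identity. *)
Definition discrete (T : Type) : Groupoid.
Proof.
unshelve refine {| gpd_cat := {| ob := T; hom := fun x y => x = y;
  idm := fun x => eq_refl; comp := fun x y z q p => eq_trans p q |} |};
  try (intros; apply proof_irrelevance).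
intros x y f; exists (eq_sym f); split; exact (proof_irrelevance (_ = _) _ _).
Defined.

Lemma discrete_hom_eq (T : Type) (x y : discrete T) (f g : hom x y) : f = g.
Proof. exact (proof_irrelevance (x = y) f g). Qed.

Definition discrete_map (S T : Type) (u : S -> T) :
  Functor (discrete S) (discrete T).
Proof.
refine {| fobj := (u : discrete S -> discrete T);
          fmap := fun x y (e : x = y) => f_equal u e |};
  intros; apply discrete_hom_eq.
Defined.

Lemma discrete_functor_eq (T S : Type) (F G : Functor (discrete T) (discrete S)) :
  (forall x, F x = G x) -> F = G.
Proof.
destruct F as [F Fm F1 F2], G as [G Gm G1 G2]; simpl; intros E.
assert (E' : F = G) by (apply functional_extensionality; exact E).
clear E; subst G.
assert (E : Fm = Gm)
  by (do 3 (apply functional_extensionality_dep; intro); apply discrete_hom_eq).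
subst Gm; f_equal; apply proof_irrelevance.
Qed.

Lemma discrete_is_identity (T : Type) (x y : discrete T) (f : hom x y) :
  is_identity f.
Proof. destruct f; exact (is_identity_idm _). Qed.

Definition discrete_ni (T S : Type) (F G : Functor (discrete T) (discrete S))
  (e : forall x, F x = G x) : NatIso F G.
Proof.
unshelve refine {|
  ni := {| nt := fun x => e x : hom (F x) (G x) |};
  ni_inv := {| nt := fun x => eq_sym (e x) : hom (G x) (F x) |} |};
  intros; apply discrete_hom_eq.
Defined.

Definition precomp (C : Category) (X A B : C) (f : hom A B) :
  Functor (discrete (hom B X)) (discrete (hom A X)) :=
  discrete_map (fun x : hom B X => x ∘ f).

(** The isomorphisms [pst_phi] are the identities given by associativity in
    [C]. *)
Definition representable (C : Category) (X : C) : Prestack C.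
Proof.
unshelve refine {|
  pst := fun A => discrete (hom A X);
  pst_map := fun A B (f : hom A B) => precomp X f;
  pst_phi := fun A B D (g : hom B D) (f : hom A B) =>
    discrete_ni (F := precomp X (g ∘ f))
      (G := functor_comp (precomp X f) (precomp X g))
      (fun x : hom D X => comp_assoc x g f) |}.
- intros A; apply discrete_functor_eq; intros x; apply comp_id_r.
- intros; apply discrete_is_identity.
- intros; apply discrete_is_identity.
- intros; apply discrete_hom_eq.
Defined.

Record PstMor (C : Category) (U V : Prestack C) : Type := {
  pm :> forall A : C, Functor (U A) (V A);
  pm_nat : forall (A B : C) (f : hom A B),
    NatIso (functor_comp (pm A) (pst_map U f))
           (functor_comp (pst_map V f) (pm B));
  pm_comp : forall (A B D : C) (g : hom B D) (f : hom A B) (x : U D),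
    pm_nat (g ∘ f) x
    = ni_inv (pst_phi V g f) (pm D x)
      ∘ fmap (pst_map V f) (pm_nat g x)
      ∘ pm_nat f (pst_map U g x)
      ∘ fmap (pm A) (pst_phi U g f x)
}.
Arguments pm_nat {C U V} _ {A B} _.

(** The compatibility [pm2_compat] with the structure isomorphisms [pm_nat] is
    part of the notion of a 2-morphism between pseudo-natural transformations
    (a modification).  If it is dropped, arbitrary families of isomorphisms
    [F A => G A] are allowed, and then the category of morphisms
    [representable X -> V] is in general not equivalent to [V X]: if the base
    category has two objects and one morphism between any two objects, and [V]
    is constant at a one-object groupoid with automorphism group Z/2, every
    such morphism would have automorphism group (Z/2)^2. *)
Record PstMor2 (C : Category) (U V : Prestack C) (F G : PstMor U V) : Type := {
  pm2 :> forall A : C, NatIso (F A) (G A);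
  pm2_compat : forall (A B : C) (f : hom A B) (x : U B),
    fmap (pst_map V f) (pm2 B x) ∘ pm_nat F f x
    = pm_nat G f x ∘ pm2 A (pst_map U f x)
}.

Definition pm2_id (C : Category) (U V : Prestack C) (F : PstMor U V) :
  PstMor2 F F.
Proof.
refine {| pm2 := fun A => ni_id (F A) |}.
intros A B f x; simpl; now rewrite fmap_id, comp_id_l, comp_id_r.
Defined.

Definition pm2_comp (C : Category) (U V : Prestack C) (F G H : PstMor U V)
  (b : PstMor2 G H) (a : PstMor2 F G) : PstMor2 F H.
Proof.
refine {| pm2 := fun A => ni_comp (b A) (a A) |}.
intros A B f x.
pose proof (pm2_compat a f x) as Ha; pose proof (pm2_compat b f x) as Hb.
simpl in *.
now rewrite fmap_comp, <- comp_assoc, Ha, comp_assoc, Hb, <- comp_assoc.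
Defined.

Lemma nt_eq (C D : Category) (F G : Functor C D) (a b : NatTrans F G) :
  (forall x, a x = b x) -> a = b.
Proof.
destruct a as [a Ha], b as [b Hb]; simpl; intros E.
assert (E' : a = b) by (apply functional_extensionality_dep; exact E).
subst b; f_equal; apply proof_irrelevance.
Qed.

Lemma ni_eq (C D : Category) (F G : Functor C D) (a b : NatIso F G) :
  (forall x, a x = b x) -> a = b.
Proof.
intros E.
assert (E' : ni_inv a = ni_inv b).
{ apply nt_eq; intros x.
  rewrite <- (comp_id_r (ni_inv a x)), <- (ni_inv_r b x), <- E.
  now rewrite comp_assoc, ni_inv_l, comp_id_l. }
apply nt_eq in E.
destruct a as [a a' Ha Ha'], b as [b b' Hb Hb']; simpl in *; subst b b'.
f_equal; apply proof_irrelevance.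
Qed.

Lemma pm2_eq (C : Category) (U V : Prestack C) (F G : PstMor U V)
  (a b : PstMor2 F G) : (forall A x, a A x = b A x) -> a = b.
Proof.
intros E.
assert (E' : pm2 a = pm2 b)
  by (apply functional_extensionality_dep; intros A; apply ni_eq, E).
destruct a as [a Ha], b as [b Hb]; simpl in *; subst b.
f_equal; apply proof_irrelevance.
Qed.

Definition PstMorCat (C : Category) (U V : Prestack C) : Category.
Proof.
refine {| ob := PstMor U V; hom := @PstMor2 C U V; idm := @pm2_id C U V;
          comp := @pm2_comp C U V |};
  intros; apply pm2_eq; intros; simpl.
- apply comp_id_l.
- apply comp_id_r.
- apply comp_assoc.
Defined.

(* Main.v *)
(** The two-dimensional Yoneda lemma: evaluation at [idm X] is a quasi-inverse
    of [y |-> (f |-> Y(f) y)].  For a 1-morphism [F] out of the representable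
    prestack, the structure isomorphism of [F] at [f : A -> X] and the object
    [idm X] identifies [F_A(f) = F_A(idm X ∘ f)] with [Y(f) (F_X (idm X))]. *)

Require Import Defs.
From Stdlib Require Import ClassicalEpsilon.

Set Implicit Arguments.
Unset Strict Implicit.
Unset Printing Implicit Defensive.

Local Open Scope cat_scope.

(** Naturality of the inverse is automatic: insert [b y ∘ a y] on the left, use naturality of [a],
    then cancel [a x ∘ b x]. *)
Definition ni_of_inverses (C D : Category) (F G : Functor C D)
  (a : NatTrans F G) (b : forall x, hom (G x) (F x))
  (ba : forall x, b x ∘ a x = idm (F x))
  (ab : forall x, a x ∘ b x = idm (G x)) : NatIso F G.
Proof.
unshelve refine {| ni := a; ni_inv := {| nt := b |} |}; try assumption.
intros x y f.
rewrite <- (comp_id_l (fmap F f ∘ b x)), <- (ba y), <- (comp_assoc (b y)).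
rewrite (comp_assoc (a y)), <- nt_natural, <- (comp_assoc (fmap G f)).
now rewrite ab, comp_id_r.
Defined.

Definition ni_sym (C D : Category) (F G : Functor C D) (a : NatIso F G) :
  NatIso G F :=
  {| ni := ni_inv a; ni_inv := a;
     ni_inv_l := ni_inv_r a; ni_inv_r := ni_inv_l a |}.

Definition ni_of_eq (C D : Category) (F G : Functor C D) (e : F = G) :
  NatIso F G :=
  match e in _ = H return NatIso F H with eq_refl => ni_id F end.

Definition pm2_inv (C : Category) (U V : Prestack C) (F G : PstMor U V)
  (a : PstMor2 F G) : PstMor2 G F.
Proof.
refine {| pm2 := fun A => ni_sym (a A) |}.
intros A B f x; simpl.
rewrite <- (comp_id_r (pm_nat G f x)); simpl.
rewrite <- (ni_inv_r (a A) (pst_map U f x)).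
rewrite (comp_assoc (pm_nat G f x)), <- pm2_compat, !comp_assoc.
now rewrite <- fmap_comp, ni_inv_l, fmap_id, comp_id_l.
Defined.

(** [is_iso] only asserts that an inverse exists, while [NatIso] carries it as data; a choice
    principle bridges the two. *)
Definition gpd_inv (G : Groupoid) (x y : G) (f : hom x y) : hom y x :=
  proj1_sig (constructive_indefinite_description _ (gpd_iso f)).

Lemma gpd_inv_l (G : Groupoid) (x y : G) (f : hom x y) : gpd_inv f ∘ f = idm x.
Proof.
exact (proj1 (proj2_sig (constructive_indefinite_description _ (gpd_iso f)))).
Qed.

Lemma gpd_inv_r (G : Groupoid) (x y : G) (f : hom x y) : f ∘ gpd_inv f = idm y.
Proof.
exact (proj2 (proj2_sig (constructive_indefinite_description _ (gpd_iso f)))).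
Qed.

Definition gpd_ni (C : Category) (G : Groupoid) (F F' : Functor C G)
  (a : NatTrans F F') : NatIso F F' :=
  ni_of_inverses (fun x => gpd_inv_l (a x)) (fun x => gpd_inv_r (a x)).

(** Stated for abstract morphisms because in [yoneda_unit] the objects involved
    agree up to conversion but not syntactically. *)
Lemma comp_cancel_square (D : Category) (a a1 a2 b b1 d e : D)
  (s : hom a a1) (t : hom a1 a2) (w : hom a a2) (n : hom a b) (n1 : hom a2 b1)
  (m : hom b b1) (k : hom b1 d) (km : hom b d) (p : hom e d) (p' : hom d e)
  (h : hom a1 e) :
  h = p' ∘ k ∘ n1 ∘ t -> m ∘ n = n1 ∘ w -> p ∘ p' = idm d -> t ∘ s = w ->
  km = k ∘ m -> km ∘ n = p ∘ (h ∘ s).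
Proof.
intros -> N P <- ->.
now rewrite !comp_assoc, P, comp_id_l, <- !comp_assoc, N.
Qed.

(** Parallel morphisms of a discrete groupoid coincide, so [r] may be any proof of the equality. *)
Lemma fmap_discrete_comp (T : Type) (D : Category) (F : Functor (discrete T) D)
  (x y z : T) (q : y = z) (p : x = y) (r : x = z) :
  @fmap _ _ F y z q ∘ @fmap _ _ F x y p = @fmap _ _ F x z r.
Proof. rewrite <- fmap_comp; apply f_equal, discrete_hom_eq. Qed.

Section Yoneda.

Variables (C : Category) (Y : Prestack C) (X : C).

(** The action on morphisms is forced: [eq_refl] must go to an identity. *)
Definition yoneda_at (y : Y X) (A : C) : Functor (representable X A) (Y A).
Proof.
refine {| fobj := fun f : representable X A => pst_map Y (f : hom A X) y;
          fmap := fun (f g : hom A X) (e : f = g) =>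
            eq_hom (f_equal (fun k => pst_map Y k y) e) |}.
- reflexivity.
- intros f g h q p; destruct p, q; simpl; symmetry; apply comp_id_l.
Defined.

Definition yoneda_nat_trans (y : Y X) (A B : C) (f : hom A B) :
  NatTrans (functor_comp (yoneda_at y A) (pst_map (representable X) f))
           (functor_comp (pst_map Y f) (yoneda_at y B)).
Proof.
unshelve refine {| nt := fun x : representable X B => _ |}.
- exact (pst_phi Y (x : hom B X) f y).
- intros x x' e; destruct e; simpl.
  now rewrite fmap_id, comp_id_l, comp_id_r.
Defined.

Definition yoneda_obj (y : Y X) : PstMor (representable X) Y.
Proof.
refine {| pm := yoneda_at y;
          pm_nat := fun A B f => gpd_ni (yoneda_nat_trans y f) |}.
intros A B D g f x; simpl in x |- *.
(* Coherence of [Y] for the triple [x], [g], [f] brings out the factor [pst_phi Y g f], which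
   cancels against its inverse. *)
rewrite <- !comp_assoc, (comp_assoc (fmap _ _)), pst_coh.
pose proof (ni_inv_l (pst_phi Y g f) (pst_map Y x y)) as H; simpl in H.
now rewrite comp_assoc, H, comp_id_l.
Defined.

Definition yoneda_hom_trans (y y' : Y X) (u : hom y y') (A : C) :
  NatTrans (yoneda_at y A) (yoneda_at y' A).
Proof.
unshelve refine {| nt := fun f : representable X A => _ |}.
- exact (fmap (pst_map Y (f : hom A X)) u).
- intros f g e; destruct e; simpl; now rewrite comp_id_l, comp_id_r.
Defined.

(** The compatibility square at [f] and [x] is the naturality of [pst_phi Y x f] along [u]. *)
Definition yoneda_hom (y y' : Y X) (u : hom y y') :
  PstMor2 (yoneda_obj y) (yoneda_obj y').
Proof.
refine {| pm2 := fun A => gpd_ni (yoneda_hom_trans u A)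
  : NatIso (yoneda_obj y A) (yoneda_obj y' A) |}.
intros A B f x; exact (nt_natural (pst_phi Y (x : hom B X) f) u).
Defined.

Definition yoneda : Functor (Y X) (PstMorCat (representable X) Y).
Proof.
refine {| fobj := yoneda_obj : Y X -> PstMorCat (representable X) Y;
          fmap := yoneda_hom |}.
- intros y; apply pm2_eq; intros A f; simpl; apply fmap_id.
- intros x y z v u; apply pm2_eq; intros A f; simpl; apply fmap_comp.
Defined.

Definition evaluation : Functor (PstMorCat (representable X) Y) (Y X).
Proof.
unshelve refine {| fobj := fun F => _; fmap := fun F G a => _ |}.
- exact ((F : PstMor (representable X) Y) X (idm X)).
- exact ((a : PstMor2 F G) X (idm X)).
- reflexivity.
- reflexivity.
Defined.

Lemma evaluation_yoneda :
  inhabited (NatIso (functor_id (Y X)) (functor_comp evaluation yoneda)).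
Proof.
pose (a := ni_of_eq (eq_sym (pst_map_id Y X))).
(* The composite and [pst_map Y (idm X)] agree by conversion on objects and morphisms, so the
   components of [a] can be reused. *)
assert (b : NatTrans (functor_id (Y X)) (functor_comp evaluation yoneda)).
{ exact {| nt := fun y => a y : hom (functor_id (Y X) y)
                                  (functor_comp evaluation yoneda y);
           nt_natural := nt_natural a |}. }
exact (inhabits (gpd_ni b)).
Qed.

(** The [fmap] factor is the image of the identity [f = idm X ∘ f], which is not a conversion. *)
Definition yoneda_unit_trans (F : PstMor (representable X) Y) (A : C) :
  NatTrans (F A) (yoneda_obj (evaluation F) A).
Proof.
unshelve refine {| nt := fun f : representable X A => _ |}.
- exact (pm_nat F (f : hom A X) (idm X) ∘
         @fmap _ _ (F A) f (idm X ∘ (f : hom A X))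
           (eq_sym (comp_id_l (f : hom A X)))).
- intros f g e; destruct e; simpl.
  pose proof (fmap_id (F A) f) as H; simpl in H; rewrite H.
  etransitivity; [apply comp_id_l | symmetry; apply comp_id_r].
Defined.

Definition yoneda_unit (F : PstMor (representable X) Y) :
  PstMor2 F (yoneda_obj (evaluation F)).
Proof.
refine {| pm2 := fun A => gpd_ni (yoneda_unit_trans F A)
  : NatIso (F A) (yoneda_obj (evaluation F) A) |}.
intros A B f x.
(* [pm_comp] expands the structure isomorphism of [F] at [x ∘ f]; its inverse [pst_phi] cancels, and
   naturality along [x = idm X ∘ x] closes the square. *)
refine (comp_cancel_square (pm_comp F x f (idm X))
  (nt_natural (pm_nat F f) (eq_sym (comp_id_l (x : hom B X))))
  (ni_inv_r (pst_phi Y x f) (F X (idm X)))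
  (fmap_discrete_comp (F A) (comp_assoc (idm X) (x : hom B X) f)
    (eq_sym (comp_id_l ((x : hom B X) ∘ f)))
    (f_equal (fun u => u ∘ f) (eq_sym (comp_id_l (x : hom B X)))))
  (fmap_comp (pst_map Y f) _ _)).
Defined.

Definition yoneda_unit_nat :
  NatTrans (functor_id (PstMorCat (representable X) Y))
           (functor_comp yoneda evaluation).
Proof.
unshelve refine {| nt := fun F => _ |}; [exact (yoneda_unit F) |].
intros F G a; apply pm2_eq; intros A f; simpl in f |- *.
(* [H] moves [a] past the structure isomorphism at [f], and [N] past the identification of [f] with
   [idm X ∘ f]. *)
pose proof (pm2_compat a f (idm X)) as H; simpl in H.
pose proof (nt_natural (a A) (eq_sym (comp_id_l f))) as N; simpl in N.
now rewrite comp_assoc, H, <- !comp_assoc, <- N.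
Defined.

Lemma yoneda_evaluation :
  inhabited (NatIso (functor_comp yoneda evaluation)
                    (functor_id (PstMorCat (representable X) Y))).
Proof.
(* The unit runs from the identity to the composite, opposite to the direction required here. *)
apply inhabits, ni_sym.
apply (ni_of_inverses (a := yoneda_unit_nat)
  (b := fun F => pm2_inv (yoneda_unit F)));
  intros F; apply pm2_eq; intros A f.
- exact (ni_inv_l (yoneda_unit F A) f).
- exact (ni_inv_r (yoneda_unit F A) f).
Qed.

End Yoneda.

Theorem lemma3p2p1 (C : Category) (Y : Prestack C) (X : C) :
  cat_equivalent (Y X) (PstMorCat (representable X) Y).
Proof.
exists (yoneda Y X), (evaluation Y X).
split; [apply evaluation_yoneda | apply yoneda_evaluation].
Qed.
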